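(* Let $q\ge 1$ and $p\ge 1$, and suppose that $\varphi$ satisfies $$\lim_{s\downarrow 0}\frac{\varphi(1-sx)}{\varphi(1-s)}=x^p\qquad\text{for all } x>0 .$$ Let $j\in\{1,\dots,d\}$ and $u\in(u_{0j},1)$, and suppose that the second derivative of $\varphi$ exists in a neighborhood of $u$, and that it is continuous at $u$ with $\varphi''(u)\neq0\neq\varphi'(u)$. Let $\boldsymbol{U}$ follow, in its upper tail, the Archimax copula with generator $\varphi$ and logistic $D$-norm $\|\cdot\|_q$. Then, conditional on $U_j=u$, the remaining components of $\boldsymbol{U}$ have asymptotically independent upper tails. Precisely, with $\psi(s):=\varphi(s)^q$, $c:=\big(\psi'(u)^2/\psi''(u)\big)^{1/(pq)}$ and $a_n:=1-\psi^{-1}(1/n)$ for $n$ large, one has for every $\boldsymbol{x}=(x_1,\dots,x_{d-1})\in\mathbb{R}^{d-1}$ with all $x_i\le0$ $$\lim_{n\to\infty}\Big(H_{j,u}\big(\boldsymbol{1}+c\,a_n\boldsymbol{x}\big)\Big)^n=\exp\Big(-\sum_{i=1}^{d-1}(-x_i)^{pq}\Big).$$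
   Context: Setting: $d\ge 2$; $\varphi:(0,1]\to[0,\infty)$ is convex and strictly decreasing with $\varphi(1)=0$ (the generator). $\|\boldsymbol{x}\|_q=\big(\sum_{i=1}^d|x_i|^q\big)^{1/q}$. $\boldsymbol{U}=(U_1,\dots,U_d)$ is a random vector with distribution function $F$ for which there is $\boldsymbol{u}_0=(u_{01},\dots,u_{0d})\in(0,1)^d$ such that for all $\boldsymbol{u}\in\prod_{i=1}^d[u_{0i},1]$, $$F(\boldsymbol{u})=\varphi^{-1}\big(\|(\varphi(u_1),\dots,\varphi(u_d))\|_q\big),$$ with the convention $\varphi^{-1}(t):=0$ for $t\ge\lim_{s\downarrow0}\varphi(s)$ when this limit is finite. $H_{j,u}$ denotes the conditional distribution function of $(U_i)_{i\ne j}$ given $U_j=u$: $$H_{j,u}\big((u_i)_{i\neq j}\big):=\lim_{\varepsilon\downarrow 0}\frac{P(U_i\le u_i,\ i\neq j,\ U_j\in(u,u+\varepsilon])}{P(U_j\in(u,u+\varepsilon])},$$ considered for $u_i\in[u_{0i},1]$, $i\ne j$. Vector operations are componentwise and $\boldsymbol{1}=(1,\dots,1)\in\mathbb{R}^{d-1}$. A distribution function has asymptotically independent upper tails if it is in the domain of attraction of a multivariate extreme value distribution function that is the product of its univariate margins. *)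

(* Defs.v *)
From HB Require Import structures.
From mathcomp Require Import all_boot all_order all_algebra.
From mathcomp Require Import all_classical all_reals all_analysis.

Set Implicit Arguments.
Unset Strict Implicit.
Unset Printing Implicit Defensive.

Import Order.TTheory GRing.Theory Num.Theory.
Import numFieldNormedType.Exports.

Local Open Scope classical_set_scope.
Local Open Scope ring_scope.

(* Only the values of [phi] on (0, 1] matter. *)
Definition is_generator (R : realType) (phi : R -> R) : Prop :=
  [/\ forall s, 0 < s <= 1 -> 0 <= phi s,
      convex_function [set s : R | 0 < s <= 1] phi,
      forall s t, 0 < s -> s < t -> t <= 1 -> phi t < phi s
    & phi 1 = 0].

(* A generator is continuous on (0, 1], with range [0, lim_(s -> 0+) phi s);
   hence for t >= 0 the default value 0 is taken exactly when
   t >= lim_(s -> 0+) phi s. *)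
Definition gen_inv (R : realType) (phi : R -> R) (t : R) : R :=
  xget 0 [set s : R | 0 < s <= 1 /\ phi s = t].

Definition qnorm (R : realType) (d : nat) (q : R) (x : 'rV[R]_d) : R :=
  (\sum_(i < d) `|x 0 i| `^ q) `^ q^-1.

Definition joint_cdf (dT : measure_display) (T : measurableType dT)
    (R : realType) (P : probability T R) (d : nat)
    (U : 'I_d -> {RV P >-> R}) (v : 'rV[R]_d) : R :=
  fine (P [set w | forall i, U i w <= v 0 i]).

(* Indexed by 'I_d.-1, the components other than j are the
   [U (lift j i)]. *)
Definition cond_cdf_ratio (dT : measure_display) (T : measurableType dT)
    (R : realType) (P : probability T R) (d : nat)
    (U : 'I_d -> {RV P >-> R}) (j : 'I_d) (u : R) (v : 'rV[R]_d.-1)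
    (e : R) : R :=
  fine (P [set w | (forall i, U (lift j i) w <= v 0 i) /\ u < U j w <= u + e])
  / fine (P [set w | u < U j w <= u + e]).

Definition cond_cdf (dT : measure_display) (T : measurableType dT)
    (R : realType) (P : probability T R) (d : nat)
    (U : 'I_d -> {RV P >-> R}) (j : 'I_d) (u : R) (v : 'rV[R]_d.-1) : R :=
  lim (cond_cdf_ratio U j u v e @[e --> 0^'+]).

Definition is_joint_cdf (R : realType) (m : nat) (G : 'rV[R]_m -> R) : Prop :=
  exists (dT : measure_display) (T : measurableType dT) (P : probability T R)
    (V : 'I_m -> {RV P >-> R}), forall x, G x = joint_cdf V x.

Definition margin (R : realType) (m : nat) (G : 'rV[R]_m -> R) (i : 'I_m)
    (t : R) : R :=
  lim (G (\row_k (if k == i then t else s)) @[s --> +oo]).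

Definition affine_rescale (R : realType) (m : nat) (a b x : 'rV[R]_m) :
    'rV[R]_m :=
  \row_i (a 0 i * x 0 i + b 0 i).

(* Multivariate extreme value distribution functions are the max-stable
   distribution functions with nondegenerate margins. *)
Definition is_mevd (R : realType) (m : nat) (G : 'rV[R]_m -> R) : Prop :=
  [/\ is_joint_cdf G,
      forall i, exists t, 0 < margin G i t < 1
    & forall n, (0 < n)%N ->
        exists a b : 'rV[R]_m, (forall i, 0 < a 0 i) /\
          forall x, G (affine_rescale a b x) ^+ n = G x].

(* Convergence is required at every point because multivariate extreme value
   distribution functions are continuous. *)
Definition in_domain_of_attraction (R : realType) (m : nat)
    (H G : 'rV[R]_m -> R) : Prop :=
  exists a b : nat -> 'rV[R]_m, (forall n i, 0 < a n 0 i) /\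
    forall x, H (affine_rescale (a n) (b n) x) ^+ n @[n --> \oo] --> G x.

Definition asymptotically_independent_upper_tails (R : realType) (m : nat)
    (H : 'rV[R]_m -> R) : Prop :=
  exists G : 'rV[R]_m -> R,
    [/\ is_mevd G,
        forall x, G x = \prod_(i < m) margin G i (x 0 i)
      & in_domain_of_attraction H G].

(* Main.v *)
Require Import Defs.
From HB Require Import structures.
From mathcomp Require Import all_boot all_order all_algebra.
From mathcomp Require Import all_classical all_reals all_analysis.
From mathcomp Require Import ring lra.

Set Implicit Arguments.
Unset Strict Implicit.
Unset Printing Implicit Defensive.

Import Order.TTheory GRing.Theory Num.Theory.
Import numFieldNormedType.Exports.

Local Open Scope classical_set_scope.
Local Open Scope ring_scope.

(** Put psi := phi^q.  It is again a generator ([generator_powR]), and the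
    hypothesis on the joint distribution function reads
    F(v) = psi^-1(sum_i psi(v_i)) near the upper corner ([gen_inv_qnorm]): the
    norm has disappeared, and everything below is about one generator psi that
    satisfies psi(1 - s x) / psi(1 - s) -> x^(pq).

    With A := sum_(i != j) psi(v_i), the ratio that defines the conditional
    distribution function is the difference quotient at u of
    s |-> psi^-1(A + psi(s)), because U_j is uniform near u
    ([cond_cdf_ratioE]).  The one-sided limit exists for every A >= 0, even
    where psi is not differentiable at psi^-1(A + psi(u)) or where psi^-1 is
    cut off to 0, because psi^-1 is convex and nonincreasing on [0, +oo)
    ([gen_inv_conv], [gen_inv_quotient_cvg]).  For small A the chain rule gives
    the limit K(A) = psi'(u) / psi'(psi^-1(A + psi(u)))
    ([gen_inv_quotient_lim]), a function of A with K(0) = 1 and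
    K'(0) = - psi''(u) / psi'(u)^2 ([is_derive_slope_ratio]).  This is negative
    because phi''(u) is nonnegative by convexity and nonzero
    ([derive2_power_gt0]).

    At the points 1 + c a_n x, regular variation and psi(1 - a_n) = 1/n give
    n A_n -> c^(pq) sum_i (- x_i)^(pq) ([tail_sum_scaling]), so that
    K(A_n)^n -> exp(K'(0) c^(pq) sum_i (- x_i)^(pq)) ([cvg_pow_derive]), and
    the constant c is the one for which K'(0) c^(pq) = - 1
    ([quotient_pow_cvg]).

    The limit is the product of m := d - 1 equal Weibull distribution functions
    exp(- (max(- t, 0))^(pq)).  It is max-stable ([weibull_joint_is_mevd]), and
    it is the limit at all points, not only at nonpositive ones, because
    U <= 1 almost surely: capping the argument of the conditional distribution
    function at 1 does not change its value ([cond_cdf_cap1]). *)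

(** * Generators and their inverses *)

Section generator.
Variables (R : realType) (phi : R -> R).
Hypothesis hphi : is_generator phi.

Lemma generator_ge0 s : 0 < s <= 1 -> 0 <= phi s.
Proof. by case: hphi => h _ _ _; exact: h. Qed.

Lemma generator_lt s t : 0 < s -> s < t -> t <= 1 -> phi t < phi s.
Proof. by case: hphi => _ _ h _; exact: h. Qed.

Lemma generator1 : phi 1 = 0.
Proof. by case: hphi. Qed.

Lemma generator_gt0 s : 0 < s < 1 -> 0 < phi s.
Proof. by move=> /andP[s0 s1]; rewrite -generator1 generator_lt. Qed.

Lemma generator_le s t : 0 < s -> s <= t -> t <= 1 -> phi t <= phi s.
Proof.
move=> s0; rewrite le_eqVlt => /predU1P[->//|st] t1.
exact/ltW/generator_lt.
Qed.

Lemma generator_conv x y t : 0 < x <= 1 -> 0 < y <= 1 -> 0 <= t <= 1 ->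
  phi (t * x + (1 - t) * y) <= t * phi x + (1 - t) * phi y.
Proof.
move=> x01 y01 /andP[t0 t1]; have [_ cphi _ _] := hphi.
by have := cphi (Itv01 t0 t1) x y; rewrite !inE /=; apply.
Qed.

Lemma generator_inj s t : 0 < s <= 1 -> 0 < t <= 1 -> phi s = phi t -> s = t.
Proof.
move=> /andP[s0 s1] /andP[t0 t1] st.
have [/generator_lt|/generator_lt|//] := ltgtP s t.
  by move=> /(_ s0 t1); rewrite st ltxx.
by move=> /(_ t0 s1); rewrite st ltxx.
Qed.

(** Chord slopes of a convex function increase; the inequality is cleared of
    denominators, and y = z is allowed. *)
Lemma generator_slope x y z : 0 < x -> x < y -> y <= z -> z <= 1 ->
  (phi y - phi z) * (y - x) <= (phi x - phi y) * (z - y).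
Proof.
move=> x0 xy yz z1; have xz : 0 < z - x by lra.
pose t := (z - y) / (z - x).
have t01 : 0 <= t <= 1.
  by rewrite /t divr_ge0 ?ler_pdivrMr ?mul1r //=; lra.
have yE : y = t * x + (1 - t) * z by rewrite /t; field; lra.
have : phi y <= t * phi x + (1 - t) * phi z.
  by rewrite [in leLHS]yE; apply: generator_conv => //; lra.
rewrite -(ler_pM2r xz) => h.
have tE : t * (z - x) = z - y by rewrite /t; field; lra.
have : (t * phi x + (1 - t) * phi z) * (z - x) =
  (t * (z - x)) * phi x + ((z - x) - t * (z - x)) * phi z by ring.
rewrite tE => e; rewrite e in h; lra.
Qed.

(** All chords in [s, 1] are flatter than the chord over [s/2, s], whose slope
    is at most phi(s/2) / (s/2) since phi >= 0.  This also covers the endpoint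
    1, where convexity alone would not give continuity. *)
Lemma generator_lipschitz s x y : 0 < s -> s <= x -> x <= y -> y <= 1 ->
  phi x - phi y <= phi (s / 2) / (s / 2) * (y - x).
Proof.
move=> s0 sx xy y1.
have := @generator_slope (s / 2) x y; have sx2 : 0 < x - s / 2 by lra.
move=> /(_ ltac:(lra) ltac:(lra) xy y1) h.
have phix0 : 0 <= phi x by apply: generator_ge0; lra.
have d0 : 0 <= phi x - phi y.
  by rewrite subr_ge0; apply: generator_le => //; lra.
rewrite mulrAC ler_pdivlMr; last lra.
apply: (@le_trans _ _ ((phi x - phi y) * (x - s / 2))).
  by rewrite ler_wpM2l//; lra.
by apply: (le_trans h); rewrite ler_wpM2r//; lra.
Qed.

Lemma generator_continuous s : 0 < s -> {within `[s, 1], continuous phi}.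
Proof.
move=> s0; apply/subspace_continuousP => x; rewrite /= in_itv/= => /andP[sx x1].
apply/cvgrPdist_le => e e0.
set L := phi (s / 2) / (s / 2).
have L0 : 0 <= L.
  rewrite /L; have [s2|s2] := leP (s / 2) 1; last lra.
  by rewrite divr_ge0// ?generator_ge0//; lra.
near=> y.
have : `[s, 1]%classic y by near: y; exact: withinT.
rewrite /= in_itv/= => /andP[sy y1].
have d0 : `|x - y| <= e / (L + 1).
  near: y; apply: cvg_within => /=.
  apply: (@cvgr_dist_le _ _ _ (nbhs x) _ id x) => //.
  by rewrite divr_gt0//; lra.
have {d0} : (L + 1) * `|x - y| <= e by rewrite mulrC -ler_pdivlMr//; lra.
apply: le_trans.
have le_L a b : s <= a -> a <= b -> b <= 1 ->
    `|phi a - phi b| <= (L + 1) * (b - a).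
  move=> sa ab b1; rewrite ger0_norm; last first.
    by rewrite subr_ge0 generator_le//; lra.
  apply: (le_trans (generator_lipschitz s0 sa ab b1)); rewrite -/L.
  by apply: ler_wpM2r; lra.
have [xy|yx] := leP x y.
  by rewrite (distrC x) (ger0_norm (x := y - x)) ?subr_ge0//; exact: le_L.
rewrite distrC (gtr0_norm (x := x - y)) ?subr_gt0//.
by apply: le_L => //; exact: ltW.
Unshelve. all: by end_near. Qed.

(** The range of phi is an interval starting at 0: this is what makes [gen_inv]
    a genuine inverse below phi(s) for every s. *)
Lemma generator_ivt s t : 0 < s <= 1 -> 0 <= t <= phi s ->
  exists2 r, s <= r <= 1 & phi r = t.
Proof.
move=> /andP[s0 s1] /andP[t0 ts].
have [] := @IVT R phi s 1 t s1 (generator_continuous s0).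
  have ps0 : 0 <= phi s by apply: generator_ge0; lra.
  by rewrite generator1 min_r// max_l// t0.
by move=> r; rewrite in_itv/= => rs <-; exists r.
Qed.

Local Notation gi := (gen_inv phi).

Lemma gen_invK s : 0 < s <= 1 -> gi (phi s) = s.
Proof.
move=> s01; apply: xget_unique => //= r [r01 rs]; exact: generator_inj.
Qed.

Lemma gen_inv_cases t :
  (0 < gi t <= 1 /\ phi (gi t) = t) \/
  (gi t = 0 /\ forall s, 0 < s <= 1 -> phi s <> t).
Proof.
rewrite /gen_inv; case: xgetP => [x _ [x01 xt]|h]; [by left|right].
by split=> // s s01 st; apply: (h s).
Qed.

Lemma gen_inv_itv t : 0 <= gi t <= 1.
Proof. by case: (gen_inv_cases t) => -[h _]; [lra|rewrite h; lra]. Qed.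

(** Together with the next lemma, this is the Galois connection between phi and
    [gen_inv phi].  It covers the values of t above the range of phi, where
    [gen_inv phi t] is the default 0 and every s qualifies. *)
Lemma generator_le_of_gen_inv_le t s : 0 <= t -> 0 < s <= 1 -> gi t <= s ->
  phi s <= t.
Proof.
move=> t0 s01; have [[/andP[g0 g1] gt] gs|[_ gt _]] := gen_inv_cases t.
  by rewrite -[leRHS]gt generator_le//; lra.
rewrite leNgt; apply/negP => ts.
have [r rs rt] := @generator_ivt s t s01 ltac:(lra).
by apply: (gt r) => //; lra.
Qed.

Lemma gen_inv_le_of_generator_le t s : 0 < s <= 1 -> phi s <= t -> gi t <= s.
Proof.
move=> s01 st; have [[/andP[g0 g1] gt]|[-> _]] := gen_inv_cases t; last lra.
rewrite leNgt; apply/negP => sg.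
have := @generator_lt s (gi t) ltac:(lra) sg g1; lra.
Qed.

Lemma generator_gen_inv t s : 0 < s <= 1 -> 0 <= t <= phi s ->
  [/\ s <= gi t, gi t <= 1 & phi (gi t) = t].
Proof.
move=> s01 ts; have [r rs <-] := generator_ivt s01 ts.
by rewrite gen_invK ?(andP rs)//; [split => //; lra|lra].
Qed.

Lemma gen_inv_anti t t' : 0 <= t -> t <= t' -> gi t' <= gi t.
Proof.
move=> t0 tt'; have [[g01 gt']|[-> _]] := gen_inv_cases t'; last first.
  by have := gen_inv_itv t; lra.
by have [] := @generator_gen_inv t _ g01 ltac:(lra).
Qed.

(** The inverse extended by 0 stays convex on [0, +oo).  Above the range of phi
    the inverse is 0, outside the domain of phi, so convexity of phi is applied
    at points of (0, 1] that exceed the inverses by at most e. *)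
Lemma gen_inv_conv t1 t2 l : 0 <= t1 -> 0 <= t2 -> 0 <= l <= 1 ->
  gi (l * t1 + (1 - l) * t2) <= l * gi t1 + (1 - l) * gi t2.
Proof.
move=> t10 t20 l01; apply/ler_addgt0Pr => e e0.
have key t : 0 <= t ->
    exists s, [/\ 0 < s <= 1, phi s <= t & s <= gi t + e].
  move=> t0; exists (Num.max (gi t) (Num.min e 1)); have := gen_inv_itv t => g.
  have s01 : 0 < Num.max (gi t) (Num.min e 1) <= 1.
    by rewrite lt_max lt_min ge_max ge_min; lra.
  split => //; first by rewrite generator_le_of_gen_inv_le// le_max lexx.
  by rewrite ge_max lerDl ltW//= ge_min; lra.
have [s1 [s101 ps1 gs1]] := key t1 t10.
have [s2 [s201 ps2 gs2]] := key t2 t20.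
apply: (@le_trans _ _ (l * s1 + (1 - l) * s2)); last by nra.
apply: gen_inv_le_of_generator_le; first by nra.
by apply: (le_trans (generator_conv s101 s201 l01)); nra.
Qed.

Lemma gen_inv_left_slope t0 h k : 0 < h -> h <= k -> k <= t0 ->
  (gi (t0 - h) - gi t0) / h <= (gi (t0 - k) - gi t0) / k.
Proof.
move=> h0 hk kt; have k0 : 0 < k by lra.
have l01 : 0 <= h / k <= 1.
  by rewrite divr_ge0 ?ler_pdivrMr ?mul1r ?hk//; lra.
have := @gen_inv_conv (t0 - k) t0 (h / k) ltac:(lra) ltac:(lra) l01.
have -> : h / k * (t0 - k) + (1 - h / k) * t0 = t0 - h by field; lra.
move=> H; rewrite ler_pdivrMr//.
have -> : (gi (t0 - k) - gi t0) / k * h = h / k * (gi (t0 - k) - gi t0) by ring.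
lra.
Qed.

(** By convexity the backward difference quotients are monotone, and they are
    nonnegative. *)
Lemma gen_inv_cvg_left t0 : 0 < t0 ->
  cvg ((gi (t0 - h) - gi t0) / h @[h --> 0^'+]).
Proof.
move=> t00; apply: nondecreasing_at_right_is_cvgr.
  near=> b => h k; rewrite !in_itv/= => /andP[h0 hb] /andP[k0 kb] hk.
  apply: gen_inv_left_slope => //; apply: (le_trans (ltW kb)).
  by near: b; exact: nbhs_right_le.
near=> b; exists 0 => _ /= [h + <-]; rewrite in_itv/= => /andP[h0 hb].
have bt : b <= t0 by near: b; exact: nbhs_right_le.
by rewrite divr_ge0// ?subr_ge0 ?(ltW h0)//; apply: gen_inv_anti; lra.
Unshelve. all: by end_near. Qed.

End generator.

(** * The conditional slope as a function of the remaining coordinates *)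

Section generator_calculus.
Variables (R : realType).
Implicit Types (phi f : R -> R) (x u w l : R).

Lemma cvg_to_at_right (T : Type) (F : set_system T) {FF : Filter F}
    (f : T -> R) (l : R) :
  f x @[x --> F] --> l -> (\forall x \near F, l < f x) ->
  f x @[x --> F] --> l^'+.
Proof.
move=> fl fgt B /fl /= H.
by apply: filterS2 fgt H => x /[swap]; apply.
Qed.

Lemma derivable_continuous f x : derivable f x 1 -> f y @[y --> x] --> f x.
Proof. by move=> /derivable1_diffP/differentiable_continuous. Qed.

Lemma derivable_is_derive f x :
  derivable f x 1 -> is_derive x 1 f (derive1 f x).
Proof. by move=> df; rewrite derive1E; exact: derivableP. Qed.

Lemma is_derive_continuous f x l : is_derive x 1 f l -> f y @[y --> x] --> f x.
Proof. by move=> [df _]; exact: derivable_continuous. Qed.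

Lemma derivable_cvg_right (f : R -> R) x : derivable f x 1 ->
  (f (x + e) - f x) / e @[e --> 0^'+] --> derive1 f x.
Proof.
move=> df; rewrite derive1E.
have : h^-1 *: (f (h *: 1 + x) - f x) @[h --> 0^'] --> 'D_1 f x by exact: df.
move=> /cvg_dnbhs_at_right; apply: cvg_trans; apply: near_eq_cvg; near=> h.
by rewrite /GRing.scale/= mulr1 (addrC x) mulrC.
Unshelve. all: by end_near. Qed.

(** As e decreases to 0, A + phi(u + e) increases to A + phi(u), so only the
    left derivative of the inverse is involved; it exists everywhere by
    convexity. *)
Lemma gen_inv_quotient_cvg phi u A : is_generator phi -> 0 < u < 1 ->
  derivable phi u 1 -> 0 <= A ->
  cvg ((gen_inv phi (A + phi (u + e)) - gen_inv phi (A + phi u)) / e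
         @[e --> 0^'+]).
Proof.
move=> hphi /andP[u0 u1] dphi A0; set t0 := A + phi u.
have phiu0 : 0 < phi u by apply: (generator_gt0 hphi); rewrite u0 u1.
have /cvg_ex[/= l gl] : cvg ((gen_inv phi (t0 - h) - gen_inv phi t0) / h
    @[h --> 0^'+]) by apply: gen_inv_cvg_left => //; rewrite /t0; lra.
pose h e := phi u - phi (u + e).
have h0 : \forall e \near 0^'+, 0 < h e.
  near=> e; have e0 : 0 < e by near: e; exact: nbhs_right_gt.
  have e1 : e <= 1 - u by near: e; apply: nbhs_right_le; lra.
  by rewrite subr_gt0; apply: (generator_lt hphi) => //; lra.
have cvgh : h e @[e --> 0^'+] --> 0^'+.
  apply: cvg_to_at_right => //; rewrite -[X in _ --> X](subrr (phi u)).
  apply: cvgB; first exact: cvg_cst.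
  apply: cvg_at_right_filter.
  have cu : u + e @[e --> (0 : R)] --> u + 0.
    by apply: cvgD; [exact: cvg_cst|exact: cvg_id].
  have : phi y @[y --> u + 0] --> phi u.
    by rewrite addr0; exact: derivable_continuous.
  exact: (cvg_comp _ _ cu).
have H : (gen_inv phi (t0 - h e) - gen_inv phi t0) / h e
      * - ((phi (u + e) - phi u) / e) @[e --> 0^'+] --> l * - derive1 phi u.
  apply: cvgM; first exact: (cvg_comp _ _ cvgh gl).
  by apply: cvgN; exact: derivable_cvg_right.
apply/cvg_ex; exists (l * - derive1 phi u).
apply: cvg_trans H; apply: near_eq_cvg.
near=> e; have he0 : 0 < h e by near: e.
rewrite /= /h; have -> : t0 - (phi u - phi (u + e)) = A + phi (u + e).
  by rewrite /t0; ring.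
have e0 : 0 < e by near: e; exact: nbhs_right_gt.
rewrite /h in he0; field.
by rewrite !gt_eqF.
Unshelve. all: by end_near. Qed.

Lemma is_derive_gen_inv phi w : is_generator phi -> 0 < w < 1 ->
  (\forall z \near w, derivable phi z 1) -> derive1 phi w != 0 ->
  is_derive (phi w) 1 (gen_inv phi) (derive1 phi w)^-1.
Proof.
move=> hphi /andP[w0 w1] dphi dw; apply: is_derive_inverse => //.
- near=> z; apply: gen_invK => //; apply/andP.
  by split; [|apply/ltW]; near: z; [exact: lt_nbhsr|exact: lt_nbhsl].
- by apply: filterS dphi => z; exact: derivable_continuous.
- by apply: derivable_is_derive; exact: nbhs_singleton dphi.
Unshelve. all: by end_near. Qed.

Section second_order.
Variables (phi : R -> R) (u : R).
Hypotheses (hphi : is_generator phi) (u01 : 0 < u < 1).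
Hypothesis dphi : \forall z \near u, derivable phi z 1.
Hypothesis ddphi : derivable (derive1 phi) u 1.
Hypothesis dphiu : derive1 phi u != 0.

Local Notation gi := (gen_inv phi).

Let u_gt0 : 0 < u. Proof. by case/andP: u01. Qed.
Let u_lt1 : u < 1. Proof. by case/andP: u01. Qed.
Let phiu_gt0 : 0 < phi u. Proof. exact: generator_gt0. Qed.

Lemma is_derive_gen_inv_at : is_derive (phi u) 1 gi (derive1 phi u)^-1.
Proof. exact: is_derive_gen_inv. Qed.

Lemma gen_inv_shift_cvg : gi (A + phi u) @[A --> 0] --> u.
Proof.
have u01' : 0 < u <= 1 by rewrite u_gt0 ltW.
have H : gi y @[y --> 0 + phi u] --> u.
  rewrite add0r -[X in _ --> X](gen_invK hphi u01').
  exact: is_derive_continuous is_derive_gen_inv_at.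
have cA : A + phi u @[A --> (0 : R)] --> 0 + phi u.
  by apply: cvgD; [exact: cvg_id|exact: cvg_cst].
exact: (cvg_comp _ _ cA H).
Qed.

Lemma near_generator_gen_inv :
  \forall A \near 0, phi (gi (A + phi u)) = A + phi u.
Proof.
have u2 : phi u < phi (u / 2).
  by have u01' := u01; apply: (generator_lt hphi); lra.
near=> A.
have A1 : - phi u < A by near: A; apply: lt_nbhsr; rewrite oppr_lt0.
have A2 : A < phi (u / 2) - phi u by near: A; apply: lt_nbhsl; rewrite subr_gt0.
have u01' := u01; have phiu0 := phiu_gt0.
by have [] := @generator_gen_inv _ _ hphi (A + phi u) (u / 2)
  ltac:(lra) ltac:(lra).
Unshelve. all: by end_near. Qed.

(** For A near 0 the point phi^-1(A + phi(u)) is close to u, where phi is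
    differentiable with nonzero derivative: the inverse function theorem and the
    chain rule apply. *)
Lemma near_is_derive_gen_inv_shift : \forall A \near 0,
  is_derive u 1 (fun s => gi (A + phi s))
    (derive1 phi u / derive1 phi (gi (A + phi u))).
Proof.
have dphi_cvg := derivable_continuous ddphi.
have : \forall w \near u, [/\ 0 < (w : R) < 1,
    (\forall z \near w, derivable phi z 1) & derive1 phi w != 0].
  near=> w; split.
  - by apply/andP; split; near: w; [exact: lt_nbhsr|exact: lt_nbhsl].
  - by near: w; have := near_join dphi; apply: filterS => w.
  - by near: w; apply: (@cvgr_neq0 _ _ _ (nbhs u) _ _ _ dphi_cvg).
move=> /gen_inv_shift_cvg near_w; near=> A.
have [w01 dw dw0] : [/\ 0 < gi (A + phi u) < 1,
    (\forall z \near gi (A + phi u), derivable phi z 1)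
    & derive1 phi (gi (A + phi u)) != 0] by near: A.
have := is_derive_gen_inv hphi w01 dw dw0.
have -> : phi (gi (A + phi u)) = A + phi u.
  by near: A; exact: near_generator_gen_inv.
move=> dgi.
rewrite mulrC; apply: (@is_derive1_comp _ gi (fun s => A + phi s)) => //.
rewrite -[X in is_derive _ _ _ X]add0r.
have dphiu' := derivable_is_derive (nbhs_singleton dphi).
exact: (@is_deriveD _ _ _ (cst A) phi _ _ _ _ (is_derive_cst _ _ _) dphiu').
Unshelve. all: by end_near. Qed.

Lemma gen_inv_quotient_lim : \forall A \near 0,
  lim ((gi (A + phi (u + e)) - gi (A + phi u)) / e @[e --> 0^'+])
    = derive1 phi u / derive1 phi (gi (A + phi u)).
Proof.
apply: filterS near_is_derive_gen_inv_shift => A [dg gE].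
by rewrite (cvg_lim _ (derivable_cvg_right dg))// derive1E.
Qed.

(** The expansion 1 - A phi''(u) / phi'(u)^2 + o(A): moving A moves the point
    phi^-1(A + phi(u)) at speed 1 / phi'(u). *)
Lemma is_derive_slope_ratio : is_derive (0 : R) 1
  (fun A : R => derive1 phi u / derive1 phi (gi (A + phi u)))
  (- (derive1n 2 phi u / derive1 phi u ^+ 2)).
Proof.
have gu : gi (0 + phi u) = u.
  by have u01' := u01; rewrite add0r (gen_invK hphi)//; lra.
have d1 : is_derive (0 : R) 1 (fun A => A + phi u) (1 + 0).
  exact: (@is_deriveD _ _ _ id (cst (phi u)) _ _ _ _
    (is_derive_id _ _) (is_derive_cst _ _ _)).
have dgi : is_derive (0 + phi u) 1 gi (derive1 phi u)^-1.
  by rewrite add0r; exact: is_derive_gen_inv_at.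
have d2 := @is_derive1_comp _ gi (fun A => A + phi u) _ _ _ dgi d1.
have ddphi' : is_derive ((gi \o (fun A => A + phi u)) 0) 1
    (derive1 phi) (derive1n 2 phi u).
  by rewrite /= gu; exact: derivable_is_derive.
have d3 := @is_derive1_comp _ (derive1 phi) _ _ _ _ ddphi' d2.
have nz : (derive1 phi \o (gi \o (fun A => A + phi u))) 0 != 0.
  by rewrite /= gu.
have d4 := @is_deriveV _ _ _ _ _ nz d3.
refine (is_derive_eq (is_deriveZ (derive1 phi u) d4) _).
rewrite /GRing.scale/= gu; move: nz; rewrite /= gu => nz.
by field.
Qed.

End second_order.
End generator_calculus.

(** * Powers of sequences and powers of generators *)

Section limits.
Variable R : realType.
Implicit Types (phi f : R -> R) (x u w l b : R).

Lemma cvg0_of_mul_natr (A : nat -> R) b :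
  n%:R * A n @[n --> \oo] --> b -> A n @[n --> \oo] --> (0 : R).
Proof.
move=> nA; rewrite -[X in _ --> X](mulr0 b).
have : (n%:R * A n) * n%:R^-1 @[n --> \oo] --> b * 0.
  apply: cvgM => //; rewrite -(cvg_shiftS (fun n => n%:R^-1 : R)).
  exact: cvg_harmonic.
apply: cvg_trans; apply: near_eq_cvg; near=> n.
have n0 : n%:R != 0 :> R.
  by rewrite pnatr_eq0 -lt0n; near: n; exact: nbhs_infty_gt.
by field.
Unshelve. all: by end_near. Qed.

Lemma cvg_mul_natr_derive f l (A : nat -> R) b :
  is_derive (0 : R) 1 f l -> f 0 = 0 ->
  n%:R * A n @[n --> \oo] --> b -> n%:R * f (A n) @[n --> \oo] --> l * b.
Proof.
move=> /is_derive1_caratheodory[g [fE gC <-]] f0 nA.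
have A0 := cvg0_of_mul_natr nA.
have : g (A n) * (n%:R * A n) @[n --> \oo] --> g 0 * b.
  by apply: cvgM => //; exact: (cvg_comp _ _ A0 gC).
apply: cvg_trans; apply: near_eq_cvg; near=> n.
have := fE (A n); rewrite f0 !subr0 => ->; ring.
Unshelve. all: by end_near. Qed.

(** (1 + l b / n + o(1 / n))^n -> exp(l b), by taking logarithms. *)
Lemma cvg_pow_derive f l (A : nat -> R) b :
  is_derive (0 : R) 1 f l -> f 0 = 1 ->
  n%:R * A n @[n --> \oo] --> b -> f (A n) ^+ n @[n --> \oo] --> expR (l * b).
Proof.
move=> df f0 nA.
have dL : is_derive (0 : R) 1 (@ln R \o f) l.
  rewrite -[l]mul1r; apply: is_derive1_comp => //.
  by rewrite f0; have := is_derive1_ln (ltr01 : 0 < 1 :> R); rewrite invr1.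
have L0 : (@ln R \o f) 0 = 0 by rewrite /= f0 ln1.
have fpos : \forall a \near (0 : R), 0 < f a.
  apply: (cvgr_gt (f 0) (is_derive_continuous df)).
  by rewrite f0.
have := cvg_mul_natr_derive dL L0 nA.
move=> /(continuous_cvg _ (@continuous_expR R _)).
apply: cvg_trans; apply: near_eq_cvg; near=> n.
rewrite /= expRM_natl lnK// posrE; near: n.
exact: (cvg0_of_mul_natr nA fpos).
Unshelve. all: by end_near. Qed.

(** The quotient (phi(x + l (y - x)) - phi x) / l tends to the left-hand side as
    l decreases to 0, and convexity bounds it by the right-hand side. *)
Lemma generator_tangent phi x y : is_generator phi -> 0 < x < 1 ->
  0 < y <= 1 -> derivable phi x 1 -> derive1 phi x * (y - x) <= phi y - phi x.
Proof.
move=> hphi x01 y01 dphi; set v := y - x.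
have d1 : is_derive (0 : R) 1 (fun l => x + l * v) v.
  apply/is_derive1_caratheodory; exists (cst v); split => // [z|].
    by rewrite /cst; ring.
  exact: cvg_cst.
have dphi0 : is_derive (x + 0 * v) 1 phi (derive1 phi x).
  by rewrite mul0r addr0; exact: derivable_is_derive.
have [d2 d2E] := @is_derive1_comp _ phi (fun l => x + l * v) 0 _ _ dphi0 d1.
have := derivable_cvg_right d2; rewrite derive1E d2E /= mul0r addr0 => H.
apply: (cvgr_to_le H); near=> l.
have l0 : 0 < l by near: l; exact: nbhs_right_gt.
have l1 : l <= 1 by near: l; exact: nbhs_right_le.
rewrite add0r ler_pdivrMr//.
have := @generator_conv _ _ hphi y x l y01 ltac:(lra) ltac:(lra).
have -> : l * y + (1 - l) * x = x + l * v by rewrite /v; ring.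
lra.
Unshelve. all: by end_near. Qed.

(** Adding the tangent inequalities at u and at u + e shows that phi' is at
    least as large at u + e as at u. *)
Lemma generator_derive2_ge0 phi u : is_generator phi -> 0 < u < 1 ->
  (\forall z \near u, derivable phi z 1) -> derivable (derive1 phi) u 1 ->
  0 <= derive1n 2 phi u.
Proof.
move=> hphi u01 dphi ddphi; have H := derivable_cvg_right ddphi.
have near_due : \forall e \near (0 : R)^'+, derivable phi (u + e) 1.
  have [r r0 rP] := (nbhs_ballP _ _).1 dphi.
  near=> e; apply: rP; rewrite /= /ball/= opprD addNKr normrN.
  have e0 : 0 < e by near: e; exact: nbhs_right_gt.
  by rewrite gtr0_norm//; near: e; exact: nbhs_right_lt.
apply: (cvgr_to_ge H); near=> e.
have e0 : 0 < e by near: e; exact: nbhs_right_gt.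
have e1 : e < 1 - u by near: e; apply: nbhs_right_lt; lra.
have due : derivable phi (u + e) 1 by near: e.
have du := nbhs_singleton dphi.
have ue1 : 0 < u + e < 1 by lra.
have := @generator_tangent _ u (u + e) hphi u01 ltac:(lra) du.
have := @generator_tangent _ (u + e) u hphi ue1 ltac:(lra) due.
move=> h1 h2; rewrite divr_ge0 ?(ltW e0)// subr_ge0.
rewrite -(ler_pM2r e0); lra.
Unshelve. all: by end_near. Qed.

Lemma generator_powR phi q : is_generator phi -> 1 <= q ->
  is_generator (fun s => phi s `^ q).
Proof.
move=> hphi q1; have q0 : 0 < q by lra.
split=> [s _|t x y| s t s0 st t1|]; first exact: powR_ge0.
- rewrite !inE /= => x01 y01; have [_ cphi _ _] := hphi.
  set l : R := t%:num.
  have l01 : 0 <= l <= 1 by rewrite /l ge0 le1.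
  have h : phi (l * x + (1 - l) * y) <= l * phi x + (1 - l) * phi y.
    exact: generator_conv.
  have xy01 : 0 < l * x + (1 - l) * y <= 1 by nra.
  have px := generator_ge0 hphi x01; have py := generator_ge0 hphi y01.
  apply: (@le_trans _ _ ((l * phi x + (1 - l) * phi y) `^ q)).
    apply: (ge0_ler_powR (ltW q0) _ _ h); rewrite nnegrE.
      exact: generator_ge0.
    by nra.
  by apply: (convex_powR q1 t); rewrite inE/= in_itv/= andbT.
- rewrite gt0_ltr_powR// ?nnegrE ?(generator_ge0 hphi)//; [lra|lra|].
  exact: (generator_lt hphi).
- by rewrite (generator1 hphi) powR0// gt_eqF.
Qed.

Lemma gen_inv_powR phi q t : is_generator phi -> 1 <= q -> 0 <= t ->
  gen_inv (fun s => phi s `^ q) t = gen_inv phi (t `^ q^-1).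
Proof.
move=> hphi q1 t0; have q0 : 0 < q by lra.
have qq : q^-1 * q = 1 by rewrite mulVf// gt_eqF.
congr (xget 0 _); apply/seteqP; split => s /= [s01 E]; split => //.
- by rewrite -E -powRrM mulfV ?gt_eqF// powRr1// (generator_ge0 hphi).
- by rewrite E -powRrM qq powRr1.
Qed.
End limits.

Section power.
Variables (R : realType) (phi : R -> R) (q u : R).
Hypotheses (hphi : is_generator phi) (q1 : 1 <= q) (u01 : 0 < u < 1).
Hypothesis dphi : \forall z \near u, derivable phi z 1.
Hypothesis ddphi : derivable (derive1 phi) u 1.
Hypothesis dphiu : derive1 phi u != 0.
Hypothesis ddphiu : derive1n 2 phi u != 0.

Local Notation psi := (fun s => phi s `^ q).

Let near_pos : \forall z \near u, 0 < phi z.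
Proof.
have /andP[u0 u1] := u01; near=> z.
apply: (generator_gt0 hphi); apply/andP; split; near: z.
  exact: lt_nbhsr.
exact: lt_nbhsl.
Unshelve. all: by end_near. Qed.

Lemma near_is_derive_power : \forall z \near u,
  is_derive (z : R) 1 psi (q * phi z `^ (q - 1) * derive1 phi z).
Proof.
near=> z.
have pz : 0 < phi z by near: z.
have dz : derivable phi z 1 by near: z.
exact: (@is_derive1_comp _ (fun y => y `^ q) phi _ _ _
  (is_derive1_powR q pz) (derivable_is_derive dz)).
Unshelve. all: by end_near. Qed.

Lemma near_derivable_power : \forall z \near u, derivable psi (z : R) 1.
Proof. by apply: filterS near_is_derive_power => z []. Qed.

Lemma derive1_power_neq0 : derive1 psi u != 0.
Proof.
have [_ dE] := nbhs_singleton near_is_derive_power.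
rewrite derive1E dE !mulf_neq0// gt_eqF//; first by have := q1; lra.
by rewrite powR_gt0// (nbhs_singleton near_pos).
Qed.

Lemma is_derive_derive1_power : is_derive u 1 (derive1 psi)
  (q * phi u `^ (q - 1) * derive1n 2 phi u
   + derive1 phi u * (q * ((q - 1) * phi u `^ (q - 1 - 1) * derive1 phi u))).
Proof.
have pu := nbhs_singleton near_pos.
apply: (@near_eq_is_derive _ _ _
    (fun z => q * phi z `^ (q - 1) * derive1 phi z)).
  apply: filterS near_is_derive_power => z [_ dE].
  by rewrite [RHS]derive1E dE.
have d1 := @is_derive1_comp _ (fun y => y `^ (q - 1)) phi _ _ _
  (is_derive1_powR (q - 1) pu) (derivable_is_derive (nbhs_singleton dphi)).
have d2 := @is_deriveZ _ _ _ _ q _ _ _ d1.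
exact: (is_deriveM d2 (derivable_is_derive ddphi)).
Qed.

Lemma derivable_derive1_power : derivable (derive1 psi) u 1.
Proof. by have [] := is_derive_derive1_power. Qed.

(** psi'' = q phi^(q-1) phi'' + q (q-1) phi^(q-2) phi'^2, where the first term
    is positive because phi''(u) is nonnegative by convexity and nonzero. *)
Lemma derive2_power_gt0 : 0 < derive1n 2 psi u.
Proof.
have pu := nbhs_singleton near_pos.
have -> : derive1n 2 psi u = 'D_1 (derive1 psi) u by rewrite -derive1E.
have [_ ->] := is_derive_derive1_power.
have q10 := q1; apply: ltr_wpDr.
  set D := derive1 phi u; set w := _ `^ (q - 1 - 1).
  have -> : D * (q * ((q - 1) * w * D)) = q * (q - 1) * w * D ^+ 2 by ring.
  by apply: mulr_ge0; rewrite ?sqr_ge0// mulr_ge0 ?powR_ge0// mulr_ge0//; lra.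
rewrite !mulr_gt0 ?powR_gt0//; first lra.
by rewrite lt_neqAle eq_sym ddphiu (generator_derive2_ge0 hphi).
Qed.

End power.

(** * Norming constants and the limit of the powers *)

Section tail.
Variables (R : realType) (psi : R -> R) (k : R).
Hypotheses (hpsi : is_generator psi) (k0 : 0 < k).
Hypothesis psi_rv : forall x : R, 0 < x ->
  psi (1 - s * x) / psi (1 - s) @[s --> 0^'+] --> x `^ k.

Local Notation a := (fun n : nat => 1 - gen_inv psi n%:R^-1).

Let near_inv_lt (e : R) : 0 < e -> \forall n \near \oo, n%:R^-1 < e.
Proof.
move=> e0.
have : n%:R^-1 @[n --> \oo] --> (0 : R).
  by rewrite -(cvg_shiftS (fun n => n%:R^-1 : R)); exact: cvg_harmonic.
by move=> /cvgr_lt; apply.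
Qed.

(** For small n, 1/n may lie above the range of psi, where the inverse is the
    default value 0; hence the restriction to large n. *)
Lemma near_generator_tail : \forall n \near \oo, psi (1 - a n) = n%:R^-1.
Proof.
have half : 0 < (2^-1 : R) <= 1 by lra.
have : 0 < psi 2^-1 by apply: (generator_gt0 hpsi); lra.
move=> /near_inv_lt; apply: filterS => n nlt.
have n0 : 0 <= n%:R^-1 :> R by rewrite invr_ge0.
rewrite opprB addrC subrK.
by have [] := @generator_gen_inv _ _ hpsi n%:R^-1 _ half ltac:(lra).
Qed.

Lemma tail_gt0 n : (0 < n)%N -> 0 < a n.
Proof.
move=> n0; have n0' : 0 < n%:R^-1 :> R by rewrite invr_gt0 ltr0n.
have [[g01 gE]|[-> _]] := gen_inv_cases psi n%:R^-1; last lra.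
rewrite subr_gt0 lt_neqAle; apply/andP; split; last by case/andP: g01.
by apply/eqP => g1; move: gE; rewrite g1 (generator1 hpsi); lra.
Qed.

Lemma tail_cvg : a n @[n --> \oo] --> 0^'+.
Proof.
apply: cvg_to_at_right; last first.
  by near=> n; apply: tail_gt0; near: n; exact: nbhs_infty_gt.
apply/cvgr0Pnorm_le => e e0.
pose s := Num.max (1 - e) 2^-1; have s01 : 0 < s < 1.
  by rewrite /s lt_max gt_max; lra.
have ps := generator_gt0 hpsi s01.
near=> n.
have n0 : (0 < n)%N by near: n; exact: nbhs_infty_gt.
have an := tail_gt0 n0.
rewrite gtr0_norm// lerBlDr -lerBlDl.
apply: (@le_trans _ _ s); first by rewrite le_max lexx.
have sE := @gen_invK _ _ hpsi s ltac:(lra); rewrite -[leLHS]sE.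
apply: (gen_inv_anti hpsi); first by rewrite invr_ge0.
by apply/ltW; near: n; exact: near_inv_lt ps.
Unshelve. all: by end_near. Qed.

(** Since psi(1 - a_n) = 1/n, the left-hand side is the ratio of the regular
    variation hypothesis along s = a_n. *)
Lemma tail_scaling y : 0 <= y ->
  n%:R * psi (1 - a n * y) @[n --> \oo] --> y `^ k.
Proof.
rewrite le_eqVlt => /predU1P[<-|y0].
  rewrite powR0 ?gt_eqF//; apply: cvg_near_cst; near=> n.
  by rewrite mulr0 subr0 (generator1 hpsi) mulr0.
have := cvg_comp _ _ tail_cvg (psi_rv y0).
apply: cvg_trans; apply: near_eq_cvg; near=> n; rewrite /=.
have -> : psi (1 - a n) = n%:R^-1 by near: n; exact: near_generator_tail.
by rewrite invrK mulrC.
Unshelve. all: by end_near. Qed.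

Lemma tail_sum_scaling (I : finType) (y : I -> R) (c : R) : 0 <= c ->
  (forall i, 0 <= y i) ->
  n%:R * (\sum_i psi (1 - c * a n * y i)) @[n --> \oo]
    --> c `^ k * \sum_i y i `^ k.
Proof.
move=> c0 y0; under eq_fun do rewrite mulr_sumr.
rewrite mulr_sumr; apply: cvg_big => [|i _].
  by move=> z; apply: cvgD; [exact: cvg_fst|exact: cvg_snd].
rewrite -powRM//.
have := tail_scaling (mulr_ge0 c0 (y0 i)).
apply: cvg_trans; apply: near_eq_cvg; near=> n.
by rewrite mulrA (mulrC (a n)).
Unshelve. all: by end_near. Qed.

Variable u : R.
Hypothesis u01 : 0 < u < 1.
Hypothesis dpsi : \forall z \near u, derivable psi z 1.
Hypothesis ddpsi : derivable (derive1 psi) u 1.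
Hypothesis dpsiu : derive1 psi u != 0.
Hypothesis ddpsiu : 0 < derive1n 2 psi u.

Local Notation c := ((derive1 psi u ^+ 2 / derive1n 2 psi u) `^ k^-1).

Lemma scale_gt0 : 0 < c.
Proof. by rewrite powR_gt0// divr_gt0// exprn_even_gt0. Qed.

(** The constant c is chosen so that c^k psi''(u) / psi'(u)^2 = 1, which cancels
    the derivative of the slope ratio at 0. *)
Lemma quotient_pow_cvg (I : finType) (y : I -> R) : (forall i, 0 <= y i) ->
  lim ((gen_inv psi (\sum_i psi (1 - c * a n * y i) + psi (u + e))
        - gen_inv psi (\sum_i psi (1 - c * a n * y i) + psi u)) / e
      @[e --> 0^'+]) ^+ n @[n --> \oo]
    --> expR (- \sum_i y i `^ k).
Proof.
move=> y0; have dd := ddpsiu; have dn := dpsiu.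
have hA := tail_sum_scaling (ltW scale_gt0) y0.
have gu : gen_inv psi (0 + psi u) = u.
  by have := u01; rewrite add0r => ?; rewrite (gen_invK hpsi)//; lra.
have K0 : derive1 psi u / derive1 psi (gen_inv psi (0 + psi u)) = 1.
  by rewrite gu divff.
have := cvg_pow_derive (is_derive_slope_ratio hpsi u01 dpsi ddpsi dpsiu) K0 hA.
have -> : - (derive1n 2 psi u / derive1 psi u ^+ 2) *
    (c `^ k * \sum_i y i `^ k) = - \sum_i y i `^ k.
  rewrite -powRrM mulVf ?gt_eqF// powRr1; last first.
    by rewrite divr_ge0 ?sqr_ge0 ?ltW.
  by field; rewrite dn gt_eqF.
apply: cvg_trans; apply: near_eq_cvg.
have A0 := cvg0_of_mul_natr hA.
have := A0 _ (gen_inv_quotient_lim hpsi u01 dpsi ddpsi dpsiu).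
move=> near_lim; near=> n.
congr (_ ^+ n); apply/esym; near: n; exact: near_lim.
Unshelve. all: by end_near.
Qed.

End tail.

(** * The conditional distribution function as a difference quotient *)

Section conditioning.
Context (dT : measure_display) (T : measurableType dT) (R : realType)
  (P : probability T R) (d : nat) (U : 'I_d -> {RV P >-> R}).

Definition below (b : 'I_d -> R) : set T := [set w | forall i, U i w <= b i].

Lemma measurable_below b : measurable (below b).
Proof.
rewrite (_ : below b = \bigcap_(i in setT) (U i @^-1` `]-oo, b i])); last first.
  apply/seteqP; split => w /=; first by move=> h i _ /=; rewrite in_itv/=.
  by move=> h i; have := h i I; rewrite /= in_itv.
apply: fin_bigcap_measurable => // i _; exact: measurable_funPTI.
Qed.

Lemma prob_setI_full (E B : set T) : measurable E -> measurable B ->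
  P E = 1%E -> P (B `&` E) = P B.
Proof.
move=> mE mB PE.
have P0 : P (B `\` E) = 0%E.
  apply/eqP; rewrite eq_le measure_ge0 andbT.
  apply: (@le_trans _ _ (P (~` E))).
    apply: le_measure; last exact: subIsetr.
      by rewrite inE; exact: measurableD.
    by rewrite inE; exact: measurableC.
  by rewrite probability_setC// PE subee.
by rewrite (measureDI P mB mE) [X in (X + _)%E]P0 add0e.
Qed.

Variables (j : 'I_d) (u : R).

Definition insert_at (v : 'rV[R]_d.-1) (s : R) : 'rV[R]_d :=
  \row_i oapp (v 0) s (unlift j i).

Lemma insert_at_lift v s i : insert_at v s 0 (lift j i) = v 0 i.
Proof. by rewrite mxE liftK. Qed.

Lemma insert_at_self v s : insert_at v s 0 j = s.
Proof. by rewrite mxE unlift_none. Qed.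

Lemma forall_lift (Q : 'I_d -> Prop) :
  (forall i, Q i) <-> Q j /\ forall i, Q (lift j i).
Proof.
split=> [h|[hj hl] i]; first by split.
by case: (unliftP j i) => [k|] ->.
Qed.

Definition slab (v : 'rV[R]_d.-1) (e : R) : set T :=
  [set w | (forall i, U (lift j i) w <= v 0 i) /\ u < U j w <= u + e].

Lemma slabE v e :
  slab v e = below (insert_at v (u + e) 0) `\` below (insert_at v u 0).
Proof.
apply/seteqP; split => w.
  move=> [h /andP[uw we]]; split.
    apply/forall_lift; rewrite insert_at_self; split => // i.
    by rewrite insert_at_lift.
  by move/forall_lift => []; rewrite insert_at_self leNgt uw.
move=> [/forall_lift[we h] nh]; rewrite insert_at_self in we.
have {}h i : U (lift j i) w <= v 0 i by rewrite -(insert_at_lift v (u + e)).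
split=> //; rewrite we andbT ltNge; apply/negP => wu; apply: nh.
apply/forall_lift; rewrite insert_at_self; split => // i.
by rewrite insert_at_lift.
Qed.

Lemma measurable_slab v e : measurable (slab v e).
Proof. by rewrite slabE; apply: measurableD; exact: measurable_below. Qed.

Lemma prob_slab v e : 0 <= e -> fine (P (slab v e)) =
  joint_cdf U (insert_at v (u + e)) - joint_cdf U (insert_at v u).
Proof.
move=> e0; rewrite slabE measureD; [|exact: measurable_below..|]; last first.
  by rewrite ltey_eq fin_num_measure//; exact: measurable_below.
rewrite setIidr.
  by rewrite fineB// fin_num_measure//; exact: measurable_below.
move=> w /forall_lift[wu h]; apply/forall_lift.
rewrite !insert_at_self in wu *; split; first by lra.
by move=> i; have := h i; rewrite !insert_at_lift.
Qed.

Definition cap1 m (v : 'rV[R]_m) : 'rV[R]_m := \row_i Num.min (v 0 i) 1.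

Hypothesis U_le1 : P (below (fun=> 1)) = 1%E.

Lemma prob_slab_cap1 v e : P (slab (cap1 v) e) = P (slab v e).
Proof.
rewrite -[LHS](prob_setI_full (measurable_below _) (measurable_slab _ _) U_le1).
rewrite -[RHS](prob_setI_full (measurable_below _) (measurable_slab _ _) U_le1).
congr (P _); apply/seteqP; split => w [[h uw] w1]; split => //; split => // i.
  by apply: (le_trans (h i)); rewrite mxE ge_min lexx.
by rewrite mxE le_min h w1.
Qed.

Lemma prob_slab_const1 e :
  P (slab (const_mx 1) e) = P [set w | u < U j w <= u + e].
Proof.
have mD : measurable [set w | u < U j w <= u + e].
  rewrite (_ : mkset _ = U j @^-1` `]u, u + e]); first exact: measurable_funPTI.
  by apply/seteqP; split => w; rewrite /= in_itv.
rewrite -[RHS](prob_setI_full (measurable_below _) mD U_le1).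
rewrite -[LHS](prob_setI_full (measurable_below _) (measurable_slab _ _) U_le1).
congr (P _); apply/seteqP; split => w; first by move=> [[_ uw] w1].
by move=> [uw w1]; split => //; split => // i; rewrite mxE.
Qed.

(** U <= 1 almost surely, so a bound above 1 on a coordinate is no stronger than
    the bound 1. *)
Lemma cond_cdf_cap1 v : cond_cdf U j u (cap1 v) = cond_cdf U j u v.
Proof.
rewrite /cond_cdf.
have -> // : cond_cdf_ratio U j u (cap1 v) = cond_cdf_ratio U j u v.
by apply/funext => e; rewrite /cond_cdf_ratio -!/(slab _ _) prob_slab_cap1.
Qed.

End conditioning.

Section archimedean.
Context (dT : measure_display) (T : measurableType dT) (R : realType)
  (P : probability T R) (d : nat) (U : 'I_d -> {RV P >-> R}).
Variables (psi : R -> R) (u0 : 'rV[R]_d) (j : 'I_d) (u : R).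
Hypotheses (hpsi : is_generator psi) (hu0 : forall i, 0 < u0 0 i < 1).
Hypothesis hU : forall v : 'rV[R]_d, (forall i, u0 0 i <= v 0 i <= 1) ->
  joint_cdf U v = gen_inv psi (\sum_i psi (v 0 i)).
Hypothesis hu : u0 0 j < u < 1.

Lemma prob_below1 : P (below U (fun=> 1)) = 1%E.
Proof.
rewrite -[LHS]fineK ?fin_num_measure//; last exact: measurable_below.
have -> : below U (fun=> 1) =
    [set w | forall i, U i w <= (const_mx 1 : 'rV[R]_d) 0 i].
  by apply/seteqP; split => w h i; have := h i; rewrite mxE.
rewrite -/(joint_cdf U (const_mx 1)) hU => [|i]; last first.
  by rewrite mxE lexx ltW//; case/andP: (hu0 i).
rewrite big1 => [|i _]; last by rewrite mxE (generator1 hpsi).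
by rewrite -(generator1 hpsi) (gen_invK hpsi)//; lra.
Qed.

Lemma joint_cdf_insert_at (v : 'rV[R]_d.-1) s :
  (forall i, u0 0 (lift j i) <= v 0 i <= 1) -> u0 0 j <= s <= 1 ->
  joint_cdf U (insert_at j v s) = gen_inv psi (\sum_i psi (v 0 i) + psi s).
Proof.
move=> hv hs; rewrite hU; last first.
  apply/(forall_lift j); rewrite insert_at_self; split => // i.
  by rewrite insert_at_lift.
rewrite (bigD1_ord j)//= insert_at_self addrC; congr (gen_inv _ (_ + _)).
by apply: eq_bigr => i _; rewrite insert_at_lift.
Qed.

(** The event of the numerator is the difference of two lower orthants.  The
    same computation with all other coordinates equal to 1, where the sum
    vanishes, evaluates the denominator to e. *)
Lemma cond_cdf_ratioE (v : 'rV[R]_d.-1) e :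
  (forall i, u0 0 (lift j i) <= v 0 i <= 1) -> 0 < e -> u + e <= 1 ->
  cond_cdf_ratio U j u v e =
    (gen_inv psi (\sum_i psi (v 0 i) + psi (u + e))
     - gen_inv psi (\sum_i psi (v 0 i) + psi u)) / e.
Proof.
move=> hv e0 ue; have hu' := hu; have h0 := hu0 j.
have hs : u0 0 j <= u <= 1 by lra.
have hse : u0 0 j <= u + e <= 1 by lra.
have h1 i : u0 0 (lift j i) <= (const_mx 1 : 'rV[R]_d.-1) 0 i <= 1.
  by rewrite mxE lexx ltW//; case/andP: (hu0 (lift j i)).
rewrite /cond_cdf_ratio -/(slab U j u v e) -(prob_slab_const1 j u prob_below1).
rewrite !prob_slab ?(ltW e0)// !joint_cdf_insert_at//.
have -> : \sum_i psi ((const_mx 1 : 'rV[R]_d.-1) 0 i) = 0.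
  by rewrite big1 // => i _; rewrite mxE (generator1 hpsi).
by rewrite !add0r !(gen_invK hpsi) 1?(addrC u) ?addrK//; lra.
Qed.

Lemma near_cond_cdf_ratioE (v : 'rV[R]_d.-1) :
  (forall i, u0 0 (lift j i) <= v 0 i <= 1) ->
  \forall e \near 0^'+, cond_cdf_ratio U j u v e =
    (gen_inv psi (\sum_i psi (v 0 i) + psi (u + e))
     - gen_inv psi (\sum_i psi (v 0 i) + psi u)) / e.
Proof.
move=> hv; have hu' := hu; near=> e; apply: cond_cdf_ratioE => //.
have : e <= 1 - u by near: e; apply: nbhs_right_le; lra.
lra.
Unshelve. all: by end_near. Qed.

Hypothesis dpsi : derivable psi u 1.

Lemma cond_cdf_ratio_cvg_lim (v : 'rV[R]_d.-1) :
  (forall i, u0 0 (lift j i) <= v 0 i <= 1) ->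
  cond_cdf_ratio U j u v e @[e --> 0^'+] -->
    lim ((gen_inv psi (\sum_i psi (v 0 i) + psi (u + e))
     - gen_inv psi (\sum_i psi (v 0 i) + psi u)) / e @[e --> 0^'+]).
Proof.
move=> hv; have hu' := hu; have h0 := hu0 j.
have S0 : 0 <= \sum_i psi (v 0 i).
  apply: sumr_ge0 => i _; apply: (generator_ge0 hpsi).
  have := hu0 (lift j i); have := hv i; lra.
have := @gen_inv_quotient_cvg _ _ u _ hpsi ltac:(lra) dpsi S0.
apply: cvg_trans; apply: near_eq_cvg.
by apply: filterS (near_cond_cdf_ratioE hv) => e ->.
Qed.

Lemma cond_cdf_ratio_cvg (v : 'rV[R]_d.-1) :
  (forall i, u0 0 (lift j i) <= v 0 i <= 1) ->
  cvg (cond_cdf_ratio U j u v e @[e --> 0^'+]).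
Proof. by move=> hv; apply: cvgP (cond_cdf_ratio_cvg_lim hv). Qed.

Lemma cond_cdfE (v : 'rV[R]_d.-1) :
  (forall i, u0 0 (lift j i) <= v 0 i <= 1) ->
  cond_cdf U j u v =
    lim ((gen_inv psi (\sum_i psi (v 0 i) + psi (u + e))
     - gen_inv psi (\sum_i psi (v 0 i) + psi u)) / e @[e --> 0^'+]).
Proof. by move=> hv; apply: cvg_lim => //; exact: cond_cdf_ratio_cvg_lim. Qed.

End archimedean.

(** * The limit distribution *)

Section iid.
Context (R : realType).

(** Independent copies of X on an iterated product space: each step adds one
    coordinate, in front of the previous ones. *)
Lemma is_joint_cdf_iid (dX : measure_display) (TX : measurableType dX)
    (Q : probability TX R) (X : {RV Q >-> R}) (m : nat) :
  is_joint_cdf (fun x : 'rV[R]_m => \prod_(i < m) fine (cdf X (x 0 i))).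
Proof.
elim: m => [|m [dT [T [P [V VE]]]]].
  exists dX, TX, Q, (fun=> X) => x; rewrite big_ord0 /joint_cdf.
  rewrite (_ : mkset _ = setT) ?probability_setT//.
  by apply/seteqP; split => // w _ [].
pose W (i : 'I_m.+1) : T * TX -> R :=
  if unlift ord0 i is Some k then V k \o fst else X \o snd.
have mW i : measurable_fun setT (W i).
  by rewrite /W; case: unlift => [k|]; exact: measurableT_comp.
pose WM i := isMeasurableFun.Build _ _ _ _ (W i) (mW i).
pose WV i : {RV (P \x Q)%E >-> R} := HB.pack (W i) (WM i).
exists _, (T * TX)%type, (P \x Q)%E, WV => x.
pose y : 'rV[R]_m := \row_i x 0 (lift ord0 i).
rewrite /joint_cdf.
have -> : [set w | forall i, WV i w <= x 0 i] =
    [set w | forall i, V i w <= y 0 i] `*` (X @^-1` `]-oo, x 0 ord0]).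
  apply/seteqP; split => -[w1 w2] /=.
    move=> h; split => [i|]; last first.
      by have := h ord0; rewrite /W unlift_none in_itv.
    by have := h (lift ord0 i); rewrite /W liftK mxE.
  rewrite in_itv/= => -[h1 h2] i; rewrite /W.
  case: unliftP => [k ->|->] //=.
  by have := h1 k; rewrite mxE.
pose A : set T := below V (y 0).
have mA : measurable A by exact: measurable_below.
have mX : measurable (X @^-1` `]-oo, x 0 ord0]) by exact: measurable_funPTI.
pose B := X @^-1` `]-oo, x 0 ord0].
transitivity (fine (P A * Q B)%E); last first.
  by congr fine; apply/esym; exact: product_measure1E.
rewrite big_ord_recl fineM ?fin_num_measure// mulrC; congr (_ * _).
by rewrite -/(joint_cdf V y) -VE; apply: eq_bigr => i _; rewrite mxE.
Qed.

End iid.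

Section weibull.
Context (R : realType) (k : R).
Hypothesis k0 : 0 < k.

Definition weibull_cdf (t : R) : R := expR (- Num.max (- t) 0 `^ k).

Lemma weibull_cdf_ge0 t : 0 <= t -> weibull_cdf t = 1.
Proof.
move=> t0; rewrite /weibull_cdf max_r; last by lra.
by rewrite powR0 ?gt_eqF// oppr0 expR0.
Qed.

Lemma weibull_cdf_le0 t : t <= 0 -> weibull_cdf t = expR (- (- t) `^ k).
Proof. by move=> t0; rewrite /weibull_cdf max_l//; lra. Qed.

Lemma weibull_nondecreasing : nondecreasing weibull_cdf.
Proof.
move=> s t st; rewrite ler_expR lerN2.
apply: ge0_ler_powR; rewrite ?nnegrE ?(ltW k0)//.
- by rewrite le_max lexx orbT.
- by rewrite le_max lexx orbT.
- by rewrite ge_max !le_max lexx orbT lerN2 st.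
Qed.

(** On the right of a point t >= 0 the function is constant; for t < 0 it is
    differentiable. *)
Lemma weibull_right_continuous : right_continuous weibull_cdf.
Proof.
move=> t; have [t0|t0] := leP 0 t.
  rewrite weibull_cdf_ge0//; apply: cvg_near_cst; near=> s.
  by apply: weibull_cdf_ge0; apply: (le_trans t0).
apply: cvg_at_right_filter.
have E : {near t, (fun s => expR (- (- s) `^ k)) =1 weibull_cdf}.
  near=> s; have /ltW s0 : s < 0 by near: s; exact: lt_nbhsl.
  by rewrite (weibull_cdf_le0 s0).
have H : expR (- (- s) `^ k) @[s --> t] --> expR (- (- t) `^ k).
  apply: continuous_cvg; first exact: continuous_expR.
  apply: cvgN.
  apply: (@continuous_cvg _ _ _ _ _ (fun s => - s) (fun y => y `^ k)).
    apply/differentiable_continuous/derivable1_diffP.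
    have nt0 : 0 < - t by lra.
    by have [] := is_derive1_powR k nt0.
  by apply: cvgN; exact: cvg_id.
rewrite -(weibull_cdf_le0 (ltW t0)) in H.
exact: (cvg_trans (near_eq_cvg E) H).
Unshelve. all: by end_near. Qed.

Lemma weibull_cvgy : weibull_cdf @ +oo --> (1 : R).
Proof.
apply: cvg_near_cst; near=> s; apply: weibull_cdf_ge0.
by near: s; exact: nbhs_pinfty_ge.
Unshelve. all: by end_near. Qed.

Lemma weibull_cvgNy : weibull_cdf @ -oo --> (0 : R).
Proof.
apply/cvgNy_compNP.
have powy : y `^ k @[y --> +oo] --> +oo.
  apply/cvgryPge => A; near=> y.
  have yA : `|A| `^ k^-1 <= y by near: y; exact: nbhs_pinfty_ge.
  apply: (le_trans (ler_norm A)).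
  rewrite -[leLHS]powRr1// -(mulVf (lt0r_neq0 k0)) powRrM.
  have y0 : 0 <= y := le_trans (powR_ge0 _ _) yA.
  by rewrite ge0_ler_powR ?nnegrE ?powR_ge0 ?(ltW k0).
have := cvg_comp _ _ powy (@cvgr_expR R).
apply: cvg_trans; apply: near_eq_cvg; near=> y.
have y0 : 0 <= y by near: y; exact: nbhs_pinfty_ge.
by rewrite /= -/(weibull_cdf (- y)) weibull_cdf_le0 ?opprK// oppr_le0.
Unshelve. all: by end_near. Qed.

Lemma weibull_variable : exists (dT : measure_display) (T : measurableType dT)
  (P : probability T R) (X : {RV P >-> R}),
  forall t, fine (cdf X t) = weibull_cdf t.
Proof.
pose m1 := isCumulative.Build R _ R weibull_cdf weibull_nondecreasing
  weibull_right_continuous.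
pose m2 := isCumulativeBounded.Build R 0 1 weibull_cdf
  weibull_cvgNy weibull_cvgy.
pose f : cumulativeBounded (0 : R) (1 : R) := HB.pack weibull_cdf m1 m2.
have fE t := congr1 fine (cdf_lebesgue_stieltjes_id f t).
exact: (ex_intro _ _ (ex_intro _ _ (ex_intro _ _ (ex_intro _ _ fE)))).
Qed.

Definition weibull_joint (m : nat) (x : 'rV[R]_m) : R :=
  \prod_(i < m) weibull_cdf (x 0 i).

Lemma weibull_joint_is_joint_cdf m : is_joint_cdf (@weibull_joint m).
Proof.
have [dT [T [P [X XE]]]] := weibull_variable.
have [dT' [T' [P' [V VE]]]] := is_joint_cdf_iid X m.
exists dT', T', P', V => x; rewrite -VE.
by apply: eq_bigr => i _; rewrite XE.
Qed.

Lemma margin_weibull_joint m (i : 'I_m) t :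
  margin (@weibull_joint m) i t = weibull_cdf t.
Proof.
apply: cvg_lim => //; apply: cvg_near_cst; near=> s.
have s0 : 0 <= s by near: s; exact: nbhs_pinfty_ge.
rewrite /weibull_joint (bigD1 i)//= mxE eqxx big1 ?mulr1// => l li.
by rewrite mxE (negbTE li) weibull_cdf_ge0.
Unshelve. all: by end_near. Qed.

(** Scaling by n^(-1/k) divides the exponent by n. *)
Lemma weibull_cdf_max_stable n t : (0 < n)%N ->
  weibull_cdf (n%:R `^ (- k^-1) * t) ^+ n = weibull_cdf t.
Proof.
move=> n0; have a0 : 0 < n%:R `^ (- k^-1) :> R by rewrite powR_gt0// ltr0n.
set a := _ `^ (- k^-1) in a0 *.
rewrite /weibull_cdf -expRM_natl; congr expR.
have -> : Num.max (- (a * t)) 0 = a * Num.max (- t) 0.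
  by rewrite maxr_pMr ?(ltW a0)// mulr0 mulrN.
rewrite powRM ?(ltW a0)//; last by rewrite le_max lexx orbT.
rewrite /a -powRrM mulNr mulVf ?gt_eqF// powR_inv1 ?ler0n//.
by rewrite mulrN mulrA divff ?mul1r// pnatr_eq0 -lt0n.
Qed.

Lemma weibull_joint_is_mevd m : is_mevd (@weibull_joint m).
Proof.
split; first exact: weibull_joint_is_joint_cdf.
  move=> i; exists (-1); rewrite margin_weibull_joint weibull_cdf_le0; last lra.
  by rewrite opprK powR1 expR_gt0 expR_lt1; lra.
move=> n n0; exists (const_mx (n%:R `^ (- k^-1))), 0; split => [i|x].
  by rewrite mxE powR_gt0// ltr0n.
rewrite /weibull_joint -prodrXl; apply: eq_bigr => i _.
by rewrite !mxE addr0 weibull_cdf_max_stable.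
Qed.

Lemma weibull_jointE m (x : 'rV[R]_m) :
  weibull_joint x = expR (- \sum_i Num.max (- x 0 i) 0 `^ k).
Proof. by rewrite -sumrN expR_sum. Qed.

End weibull.

(** * Reduction to a single generator, and the theorem *)

Section reduction.
Variables (R : realType) (phi : R -> R) (q p : R).
Hypotheses (hphi : is_generator phi) (q1 : 1 <= q).

(** The q-norm is the q-th root of the sum of the values of phi^q, and inverting
    phi at a q-th root is inverting phi^q. *)
Lemma gen_inv_qnorm d (u0 : 'rV[R]_d) (hu0 : forall i, 0 < u0 0 i < 1)
    (v : 'rV[R]_d) : (forall i, u0 0 i <= v 0 i <= 1) ->
  gen_inv phi (qnorm q (\row_i phi (v 0 i))) =
  gen_inv (fun s => phi s `^ q) (\sum_i phi (v 0 i) `^ q).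
Proof.
move=> hv.
have S0 : 0 <= \sum_i phi (v 0 i) `^ q.
  by apply: sumr_ge0 => i _; exact: powR_ge0.
rewrite (gen_inv_powR hphi q1 S0).
congr (gen_inv phi (_ `^ _)); apply: eq_bigr => i _.
rewrite mxE ger0_norm// (generator_ge0 hphi)//.
by have := hv i; have := hu0 i; lra.
Qed.

Lemma regular_variation_powR x : 0 < x ->
  phi (1 - s * x) / phi (1 - s) @[s --> 0^'+] --> x `^ p ->
  phi (1 - s * x) `^ q / phi (1 - s) `^ q @[s --> 0^'+] --> x `^ (p * q).
Proof.
move=> x0 H; have xp0 : 0 < x `^ p by rewrite powR_gt0.
have H2 : (phi (1 - s * x) / phi (1 - s)) `^ q @[s --> 0^'+] --> x `^ (p * q).
  rewrite powRrM.
  apply: (@continuous_cvg _ _ _ _ _ _ (fun y => y `^ q)) => //.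
  apply/differentiable_continuous/derivable1_diffP.
  by have [] := is_derive1_powR q xp0.
apply: cvg_trans H2; apply: near_eq_cvg; near=> s.
have s0 : 0 < s by near: s; exact: nbhs_right_gt.
have s1 : s < 1 by near: s; exact: nbhs_right_lt.
have sx : s <= x^-1 / 2.
  by near: s; apply: nbhs_right_le; rewrite divr_gt0// invr_gt0.
have sx1 : s * x <= 2^-1.
  by rewrite -ler_pdivlMr// mulrC.
have sx0 : 0 < s * x by rewrite mulr_gt0.
have h1 : 0 < phi (1 - s) by apply: (generator_gt0 hphi); lra.
have h2 : 0 <= phi (1 - s * x) by apply: (generator_ge0 hphi); lra.
have -> : phi (1 - s * x) `^ q =
    (phi (1 - s * x) / phi (1 - s)) `^ q * phi (1 - s) `^ q.
  by rewrite -powRM ?divr_ge0 ?(ltW h1)// divfK// gt_eqF.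
by rewrite mulfK// gt_eqF// powR_gt0.
Unshelve. all: by end_near. Qed.
End reduction.

Section conclusion.
Context (dT : measure_display) (T : measurableType dT) (R : realType)
  (P : probability T R) (d : nat) (U : 'I_d -> {RV P >-> R}).
Variables (psi : R -> R) (k : R) (u0 : 'rV[R]_d) (j : 'I_d) (u : R).
Hypotheses (hpsi : is_generator psi) (hu0 : forall i, 0 < u0 0 i < 1).
Hypothesis hU : forall v : 'rV[R]_d, (forall i, u0 0 i <= v 0 i <= 1) ->
  joint_cdf U v = gen_inv psi (\sum_i psi (v 0 i)).
Hypothesis hu : u0 0 j < u < 1.
Hypothesis k0 : 0 < k.
Hypothesis psi_rv : forall x : R, 0 < x ->
  psi (1 - s * x) / psi (1 - s) @[s --> 0^'+] --> x `^ k.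
Hypothesis dpsi : \forall z \near u, derivable psi z 1.
Hypothesis ddpsi : derivable (derive1 psi) u 1.
Hypothesis dpsiu : derive1 psi u != 0.
Hypothesis ddpsiu : 0 < derive1n 2 psi u.

Local Notation c := ((derive1 psi u ^+ 2 / derive1n 2 psi u) `^ k^-1).
Local Notation a := (fun n : nat => 1 - gen_inv psi n%:R^-1).

(** Since a_n -> 0, the points 1 + c a_n x eventually enter the region where the
    joint distribution function is known. *)
Lemma cond_cdf_pow_cvg (x : 'rV[R]_d.-1) : (forall i, x 0 i <= 0) ->
  cond_cdf U j u (const_mx 1 + (c * a n) *: x) ^+ n @[n --> \oo]
    --> expR (- \sum_(i < d.-1) (- x 0 i) `^ k).
Proof.
move=> x0; have hu' := hu; have h0 := hu0 j.
have u01 : 0 < u < 1 by lra.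
have c0 := scale_gt0 k dpsiu ddpsiu.
have x0' i : 0 <= - x 0 i by rewrite oppr_ge0.
have := quotient_pow_cvg hpsi k0 psi_rv u01 dpsi ddpsi dpsiu ddpsiu x0'.
apply: cvg_trans; apply: near_eq_cvg.
have near_u0 : \forall n \near \oo, forall i,
    u0 0 (lift j i) <= 1 + c * a n * x 0 i.
  apply: filter_forall => i.
  have : c * a n * x 0 i @[n --> \oo] --> c * 0 * x 0 i.
    apply: cvgM; last exact: cvg_cst.
    apply: cvgM; first exact: cvg_cst.
    exact: cvg_trans (tail_cvg hpsi) (cvg_within _).
  rewrite mulr0 mul0r => /cvgr_ge/(_ (u0 0 (lift j i) - 1)).
  have := hu0 (lift j i); case/andP=> _ ui1.
  rewrite subr_lt0 => /(_ ui1); apply: filterS => n; lra.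
near=> n; rewrite /= (cond_cdfE hpsi hu0 hU hu (nbhs_singleton dpsi)).
  have -> : \sum_(i < d.-1) psi ((const_mx 1 + (c * a n) *: x) 0 i) =
      \sum_(i < d.-1) psi (1 - c * a n * - x 0 i).
    by apply: eq_bigr => i _; rewrite !mxE mulrN opprK.
  by [].
move=> i; rewrite !mxE; apply/andP; split.
  by move: i; near: n.
have an : 0 < a n by apply: (tail_gt0 hpsi); near: n; exact: nbhs_infty_gt.
rewrite gerDl mulr_ge0_le0// mulr_ge0 ?ltW//.
Unshelve. all: by end_near. Qed.

(** For n > 0, capping 1 + c a_n x at 1 amounts to replacing x by min(x, 0), so
    convergence at nonpositive points suffices. *)
Lemma cond_cdf_asymptotically_independent :
  asymptotically_independent_upper_tails (cond_cdf U j u).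
Proof.
exists (@weibull_joint R k d.-1); split.
- exact: weibull_joint_is_mevd.
- by move=> x; apply: eq_bigr => i _; rewrite margin_weibull_joint.
have c0 := scale_gt0 k dpsiu ddpsiu.
(* The norming constants must be positive for every n, while a 0 = 0. *)
exists (fun n => const_mx (if (0 < n)%N then c * a n else 1)).
exists (fun=> const_mx 1).
split=> [n i|x].
  by rewrite mxE; case: ifPn => // n0; rewrite mulr_gt0// (tail_gt0 hpsi).
pose y : 'rV[R]_d.-1 := \row_i Num.min (x 0 i) 0.
have y0 i : y 0 i <= 0 by rewrite mxE ge_min lexx orbT.
have -> : weibull_joint k x = expR (- \sum_(i < d.-1) (- y 0 i) `^ k).
  rewrite weibull_jointE; congr (expR (- _)); apply: eq_bigr => i _.
  by rewrite mxE oppr_min oppr0.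
apply: cvg_trans (cond_cdf_pow_cvg y0); apply: near_eq_cvg; near=> n.
have n0 : (0 < n)%N by near: n; exact: nbhs_infty_gt.
rewrite -[in RHS](cond_cdf_cap1 j u (prob_below1 hpsi hu0 hU)).
congr (cond_cdf _ _ _ _ ^+ _); apply/rowP => i; rewrite !mxE n0.
have ca : 0 < c * a n by rewrite mulr_gt0// (tail_gt0 hpsi).
rewrite minr_pMr ?(ltW ca)// mulr0.
by rewrite [in RHS]addrC addr_minr addr0.
Unshelve. all: by end_near. Qed.

End conclusion.

Theorem mainTheorem2 (R : realType) (d : nat) (hd : (2 <= d)%N)
    (phi : R -> R) (hphi : is_generator phi)
    (q p : R) (hq : 1 <= q) (hp : 1 <= p)
    (hphi_rv : forall x : R, 0 < x ->
       phi (1 - s * x) / phi (1 - s) @[s --> 0^'+] --> x `^ p)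
    (dT : measure_display) (T : measurableType dT) (P : probability T R)
    (U : 'I_d -> {RV P >-> R})
    (u0 : 'rV[R]_d) (hu0 : forall i, 0 < u0 0 i < 1)
    (hU : forall v : 'rV[R]_d, (forall i, u0 0 i <= v 0 i <= 1) ->
       joint_cdf U v = gen_inv phi (qnorm q (\row_i phi (v 0 i))))
    (j : 'I_d) (u : R) (hu : u0 0 j < u < 1)
    (hphi2 : \forall s \near u,
       derivable phi s 1 /\ derivable (derive1 phi) s 1)
    (hphi2c : {for u, continuous (derive1n 2 phi)})
    (hphi1_neq0 : derive1 phi u != 0) (hphi2_neq0 : derive1n 2 phi u != 0) :
  let psi : R -> R := fun s => phi s `^ q in
  let c : R := (derive1 psi u ^+ 2 / derive1n 2 psi u) `^ (p * q)^-1 in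
  let a : nat -> R := fun n => 1 - gen_inv psi n%:R^-1 in
  [/\ forall v : 'rV[R]_d.-1, (forall i, u0 0 (lift j i) <= v 0 i <= 1) ->
        cvg (cond_cdf_ratio U j u v e @[e --> 0^'+]),
      asymptotically_independent_upper_tails (cond_cdf U j u)
    & forall x : 'rV[R]_d.-1, (forall i, x 0 i <= 0) ->
        cond_cdf U j u (const_mx 1 + (c * a n) *: x) ^+ n @[n --> \oo]
          --> expR (- \sum_(i < d.-1) (- x 0 i) `^ (p * q))].
Proof.
move=> psi c a.
have hpsi : is_generator psi by exact: generator_powR.
have h0 := hu0 j; have u01 : 0 < u < 1 by lra.
have pq0 : 0 < p * q by rewrite mulr_gt0//; lra.
have hUpsi (v : 'rV[R]_d) : (forall i, u0 0 i <= v 0 i <= 1) ->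
    joint_cdf U v = gen_inv psi (\sum_i psi (v 0 i)).
  by move=> hv; rewrite hU// (gen_inv_qnorm hphi hq hu0).
have psi_rv (x : R) : 0 < x ->
    psi (1 - s * x) / psi (1 - s) @[s --> 0^'+] --> x `^ (p * q).
  by move=> x0; apply: regular_variation_powR => //; exact: hphi_rv.
have dphi : \forall z \near u, derivable phi z 1.
  by apply: filterS hphi2 => z [].
have ddphi : derivable (derive1 phi) u 1 by have [] := nbhs_singleton hphi2.
have dpsi : \forall z \near u, derivable psi z 1.
  exact: near_derivable_power.
have ddpsi : derivable (derive1 psi) u 1.
  exact: derivable_derive1_power.
have dpsiu : derive1 psi u != 0 by exact: derive1_power_neq0.
have ddpsiu : 0 < derive1n 2 psi u by exact: derive2_power_gt0.
split.
- move=> v hv.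
  exact: (cond_cdf_ratio_cvg hpsi hu0 hUpsi hu (nbhs_singleton dpsi)).
- exact: (cond_cdf_asymptotically_independent hpsi hu0 hUpsi hu pq0 psi_rv).
- exact: (cond_cdf_pow_cvg hpsi hu0 hUpsi hu pq0 psi_rv).
Qed.
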